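(* Let $p$ be an odd prime. (a) Let $q$ be a prime and $k$ a positive integer, and, when $q\neq p$, let $r = \mathrm{Ord}_p(q)$. Then $$\nu_p(\sigma(q^k)) = \begin{cases} \nu_p(k+1), & \text{if } q\equiv 1 \pmod p,\\ 0, & \text{if } p=q \text{ or } (q\not\equiv 1 \pmod p \text{ and } k\not\equiv -1 \pmod r),\\ \nu_p(k+1)+\nu_p(q^r-1), & \text{otherwise.}\end{cases}$$ (b) Consequently, for every positive integer $n$, $$\nu_p(\sigma(n)) = \sum_{\substack{q\mid n\\ q\equiv 1 \bmod p}} \nu_p(\nu_q(n)+1) + \sum_{\substack{q\mid n,\ q\neq p\\ q\not\equiv 1 \bmod p\\ \mathrm{Ord}_p(q)\,\mid\,(\nu_q(n)+1)}} \left(\nu_p(\nu_q(n)+1)+\nu_p\left(q^{\mathrm{Ord}_p(q)}-1\right)\right),$$ where $q$ runs over the primes dividing $n$ with the indicated properties.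
   Context: For a prime $p$ and a positive integer $m$, $\nu_p(m)$ denotes the exponent of the highest power of $p$ dividing $m$. $\sigma(n)$ denotes the sum of the positive divisors of $n$. For a prime $q\ne p$, $\mathrm{Ord}_p(q)$ is the order of $q$ modulo $p$, i.e. the minimal positive integer $r$ with $q^r\equiv 1 \pmod p$. *)

(* Defs.v *)
From mathcomp Require Import all_boot all_order all_algebra cyclic.

Set Implicit Arguments.
Unset Strict Implicit.
Unset Printing Implicit Defensive.

Definition sigma (n : nat) : nat := \sum_(d <- divisors n) d.

Lemma Ord_ex (p q : nat) :
  exists r, (0 < r) && (coprime q p ==> (q ^ r == 1 %[mod p])).
Proof.
have [cqp|_] := boolP (coprime q p); last by exists 1.
case: p cqp => [|p] cqp; first by exists 1; move: cqp; rewrite /coprime gcdn0.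
by exists (totient p.+1); rewrite totient_gt0 /=; apply/eqP/Euler_exp_totient.
Qed.

(* The least r > 0 with q ^ r = 1 %[mod p] when q is coprime to p (Ord_spec);
   the junk value 1 otherwise. *)
Definition Ord (p q : nat) : nat := ex_minn (Ord_ex p q).

Lemma Ord_spec (p q : nat) : coprime q p ->
  [/\ 0 < Ord p q, q ^ Ord p q = 1 %[mod p] &
      forall r, 0 < r -> q ^ r = 1 %[mod p] -> Ord p q <= r].
Proof.
rewrite /Ord => cqp; case: ex_minnP => r; rewrite cqp /= => /andP[r0 /eqP er] m.
by split=> // s s0 es; apply: m; rewrite s0; apply/eqP.
Qed.

(* Main.v *)
(** The divisor sum of [q ^ k] is the geometric sum [1 + q + ... + q ^ k].  If
    [q] is [1] mod [p], its [p]-adic valuation is that of its number of terms: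
    by [geom_sumM] it suffices to treat a number of terms prime to [p], where
    the sum is that number mod [p], and [p] terms, where for [p] odd the sum is
    [p] mod [p ^ 2].  Otherwise [p] does not divide [q - 1], so the valuation
    is that of [q ^ (k + 1) - 1], which is positive only if the order [r] of [q]
    divides [k + 1]; then [geom_sumM] splits the sum into [r] terms of ratio [q]
    and [(k + 1) / r] terms of ratio [q ^ r], the latter being [1] mod [p]. *)

Require Import Defs.
From mathcomp Require Import all_boot all_order all_algebra.
From mathcomp Require Import cyclic ring.

Lemma geom_sum_gt0 (a n : nat) : 0 < n -> 0 < \sum_(i < n) a ^ i.
Proof. by case: n => // n _; rewrite big_ord_recl. Qed.

Lemma geom_sumM (a m n : nat) :
  \sum_(i < m * n) a ^ i = (\sum_(i < m) a ^ i) * \sum_(j < n) (a ^ m) ^ j.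
Proof.
elim: n => [|n IHn]; first by rewrite muln0 !big_ord0 muln0.
rewrite mulnS addnC big_split_ord /= IHn big_ord_recr /= mulnDr -expnM.
by congr addn; rewrite big_distrl; apply: eq_bigr => i _; rewrite expnD mulnC.
Qed.

Lemma modn_geom_sum (d a n : nat) :
  a = 1 %[mod d] -> \sum_(i < n) a ^ i = n %[mod d].
Proof.
move=> a1; rewrite -modn_summ (eq_bigr (fun=> 1 %% d)) => [|i _].
  by rewrite modn_summ sum1_card card_ord.
by rewrite -modnXm a1 modnXm exp1n.
Qed.

Lemma modn_exp_succ_sqr (d i : nat) :
  (1 + d) ^ i = 1 + i * d %[mod d ^ 2].
Proof.
have [c ->] : exists c, (1 + d) ^ i = c * d ^ 2 + (1 + i * d).
  elim: i => [|i [c IHi]]; first by exists 0; rewrite expn0.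
  (* The witness collects the coefficient of [d ^ 2] in [(1 + d) * (c * d ^ 2 + 1 + i * d)]. *)
  by exists (i + c + c * d); rewrite expnS IHi; ring.
by rewrite modnMDl.
Qed.

(** With [a = 1 + b] and [d] dividing [b], the [i]-th term is [1 + i * b] mod [d ^ 2]. The linear
    parts add up to [b * d * (d - 1) / 2], which vanishes mod [d ^ 2] because [(d - 1) / 2] is an
    integer for odd [d]. *)
Lemma modn_geom_sum_odd (d a : nat) :
  odd d -> 1 < d -> a = 1 %[mod d] -> \sum_(i < d) a ^ i = d %[mod d ^ 2].
Proof.
move=> d_odd d_gt1 a1; rewrite [a](divn_eq a d) a1 (modn_small d_gt1) addnC.
set b := a %/ d * d; have sqr_b: d ^ 2 %| b ^ 2 by rewrite expnMn dvdn_mull.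
rewrite -modn_summ (eq_bigr (fun i : 'I_d => (1 + i * b) %% d ^ 2)) => [|i _].
  rewrite modn_summ big_split /= sum1_card card_ord -big_distrl /=.
  rewrite -(big_mkord xpredT id) bin2_sum bin2odd // addnC.
  have -> : d * d.-1./2 * b = d.-1./2 * (a %/ d) * d ^ 2 by rewrite /b; ring.
  by rewrite modnMDl.
by rewrite -[LHS](modn_dvdm _ sqr_b) modn_exp_succ_sqr modn_dvdm.
Qed.

Lemma logn_geom_sum (p a n : nat) : prime p -> odd p -> a = 1 %[mod p] ->
  0 < n -> logn p (\sum_(i < n) a ^ i) = logn p n.
Proof.
move=> p_prime p_odd a1 n_gt0; have p_gt1 := prime_gt1 p_prime.
have p_gt0 := prime_gt0 p_prime.
have [m pm ->] := pfactor_coprime p_prime n_gt0.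
have m_gt0 : 0 < m.
  by case: m pm => //; rewrite prime_coprime // dvdn0.
rewrite geom_sumM logn_Gauss; last first.
  by rewrite -coprime_modr modn_geom_sum // coprime_modr.
rewrite logn_Gauss // pfactorK //.
have : a ^ m = 1 %[mod p] by rewrite -modnXm a1 modnXm exp1n.
(* The ratio is generalised because splitting off one block of [p] terms replaces [b] by [b ^ p],
   which is still 1 mod [p]. *)
elim: (logn p n) (a ^ m) => [|e IHe] b b1.
  by rewrite expn0 big_ord1 logn1.
rewrite expnS geom_sumM lognM ?geom_sum_gt0 ?expn_gt0 ?p_gt0 // IHe; last first.
  by rewrite -modnXm b1 modnXm exp1n.
rewrite -add1n; congr (_ + e); apply/eqP; rewrite eqn_leq.
have s_gt0 := geom_sum_gt0 b _ p_gt0.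
have sE := modn_geom_sum_odd _ _ p_odd p_gt1 b1.
(* The block of [p] terms has valuation exactly 1: it is [p], hence nonzero, mod [p ^ 2], and 0 mod
   [p]. *)
rewrite leqNgt -!pfactor_dvdn // /dvdn sE.
rewrite modn_small ?expn1; last by rewrite -{1}[p]expn1 ltn_exp2l.
by rewrite -lt0n p_gt0 modn_geom_sum // modnn /=.
Qed.

Lemma logn_geom_sum_neq1 (p q n : nat) : prime p -> 0 < q ->
  q != 1 %[mod p] -> logn p (\sum_(i < n) q ^ i) = logn p (q ^ n - 1).
Proof.
move=> p_prime q_gt0 q1; rewrite !subn1 predn_exp -subn1 logn_Gauss //.
by rewrite prime_coprime // -eqn_mod_dvd.
Qed.

Lemma Ord_dvdn (p q n : nat) : coprime q p ->
  (Ord p q %| n) = (q ^ n == 1 %[mod p]).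
Proof.
move=> qp; have [r_gt0 r1 r_min] := Ord_spec qp.
have qr k : q ^ (k * Ord p q) = 1 %[mod p].
  by rewrite mulnC expnM -modnXm r1 modnXm exp1n.
rewrite {2}(divn_eq n (Ord p q)) expnD -modnMml qr modnMml mul1n /dvdn.
have := ltn_pmod n r_gt0; case: (n %% _) => [|m] m_lt; first by rewrite expn0 !eqxx.
by symmetry; apply/negP => /eqP /(r_min m.+1 isT); rewrite leqNgt m_lt.
Qed.

(** By Euler's theorem the order is at most [p - 1]. Dividing [k + 1] by the order therefore
    preserves its valuation at [p]. *)
Lemma coprime_Ord (p q : nat) : prime p -> coprime q p -> coprime p (Ord p q).
Proof.
move=> p_prime qp; have [r_gt0 _ r_min] := Ord_spec qp.
rewrite prime_coprime // gtnNdvd //.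
apply: leq_ltn_trans (r_min _ _ (Euler_exp_totient qp)) _.
  by rewrite totient_gt0 prime_gt0.
by rewrite totient_prime // ltn_predL prime_gt0.
Qed.

Lemma sigma_primeX (q k : nat) :
  prime q -> sigma (q ^ k) = \sum_(i < k.+1) q ^ i.
Proof.
move=> q_prime; rewrite /sigma -(big_mkord xpredT (expn q)).
rewrite -(big_map (expn q) xpredT id); apply: perm_big; apply: uniq_perm.
- exact: divisors_uniq.
- by rewrite map_inj_uniq ?iota_uniq //; apply: expnI; apply: prime_gt1.
move=> d; rewrite -dvdn_divisors ?expn_gt0 ?prime_gt0 //.
apply/dvdn_pfactor/mapP => // [[m le_mk ->]|[m]].
  by exists m; rewrite ?mem_index_iota.
by rewrite mem_index_iota => /andP[_ le_mk] ->; exists m.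
Qed.

Lemma sigma_gt0 (n : nat) : 0 < n -> 0 < sigma n.
Proof.
move=> n_gt0; rewrite /sigma (big_rem n) ?divisors_id //=.
by rewrite ltn_addr.
Qed.

Lemma sigma_coprime (m n : nat) : 0 < m -> 0 < n -> coprime m n ->
  sigma (m * n) = sigma m * sigma n.
Proof.
move=> m_gt0 n_gt0 mn; rewrite /sigma big_distrlr /=.
rewrite -(@big_allpairs_dep _ _ _ _ _ _ muln _ _ id).
apply: perm_big; apply: uniq_perm; first exact: divisors_uniq.
  apply: allpairs_uniq; try exact: divisors_uniq.
  move=> _ _ /allpairsP[[a b] /= [am bn ->]] /allpairsP[[c d] /= [cm dn ->]] /=.
  move: am bn cm dn; rewrite -!dvdn_divisors // => am bn cm dn eq_abcd.
  (* A product of a divisor of [m] and a divisor of [n] determines both factors, as its gcds with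
     [m] and [n]; this gives injectivity. *)
  have gcdE x y : x %| m -> y %| n -> gcdn m (x * y) = x /\ gcdn n (x * y) = y.
    move=> xm yn; rewrite Gauss_gcdl ?(coprime_dvdr yn) //.
    rewrite Gauss_gcdr; last by rewrite coprime_sym (coprime_dvdl xm).
    by split; apply/gcdn_idPr.
  have [aE bE] := gcdE a b am bn; have [cE dE] := gcdE c d cm dn.
  by congr pair; [rewrite -aE eq_abcd cE | rewrite -bE eq_abcd dE].
move=> d; rewrite -dvdn_divisors ?muln_gt0 ?m_gt0 //.
apply/idP/allpairsP => [dmn|[[a b] /= [am bn ->]]].
  exists (gcdn d m, gcdn d n).
  rewrite /= -!dvdn_divisors ?dvdn_gcdr //; split=> //.
  have gcd_mn : coprime (gcdn d m) (gcdn d n).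
    by rewrite (coprime_dvdl (dvdn_gcdr _ _)) // (coprime_dvdr (dvdn_gcdr _ _)).
  apply/eqP; rewrite eqn_dvd Gauss_dvd // !dvdn_gcdl andbT.
  by rewrite muln_gcdr !muln_gcdl !dvdn_gcd dmn (dvdn_mull m) // !dvdn_mulr.
by apply: dvdn_mul; rewrite dvdn_divisors.
Qed.

Lemma sigma_prod_primes (e : nat -> nat) (s : seq nat) : uniq s -> all prime s ->
  sigma (\prod_(q <- s) q ^ e q) = \prod_(q <- s) sigma (q ^ e q).
Proof.
elim: s => [|q s IHs] /=; first by rewrite !big_nil /sigma big_seq1.
case/andP=> qs s_uniq /andP[q_prime s_prime]; rewrite !big_cons.
have s_gt0 : 0 < \prod_(x <- s) x ^ e x.
  rewrite big_seq; apply: prodn_cond_gt0 => x /(allP s_prime) x_prime.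
  by rewrite expn_gt0 prime_gt0.
rewrite sigma_coprime ?IHs ?expn_gt0 ?(prime_gt0 q_prime) //.
rewrite big_seq; apply: coprimeXl.
apply: (big_ind (coprime q)) => [|x y cx cy|x xs].
- exact: coprimen1.
- by rewrite coprimeMr cx.
apply: coprimeXr; rewrite prime_coprime // (dvdn_prime2 q_prime (allP s_prime x xs)).
by apply: contraNneq qs => ->.
Qed.

Lemma logn_sigma (p n : nat) : 0 < n ->
  logn p (sigma n) = \sum_(q <- primes n) logn p (sigma (q ^ logn q n)).
Proof.
move=> n_gt0; rewrite {1}(prod_prime_decomp n_gt0) prime_decompE big_map /=.
rewrite sigma_prod_primes ?primes_uniq //; last first.
  by apply/allP => q; rewrite mem_primes => /andP[].
rewrite big_seq [RHS]big_seq.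
(* Positivity is carried along with the valuation, since [lognM] needs nonzero factors. *)
pose K x y := 0 < x /\ logn p x = y.
suff [] : K (\prod_(q <- primes n | q \in primes n) sigma (q ^ logn q n))
  (\sum_(q <- primes n | q \in primes n) logn p (sigma (q ^ logn q n))) by [].
apply: (big_ind2 K) => [|x1 x2 y1 y2 [x1_gt0 <-] [y1_gt0 <-]|q].
- by split; rewrite ?logn1.
- by split; rewrite ?muln_gt0 ?x1_gt0 ?lognM.
rewrite mem_primes => /andP[q_prime _]; split=> //.
by apply: sigma_gt0; rewrite expn_gt0 prime_gt0.
Qed.

Lemma eqz_modN1 (r k : nat) :
  (k%:Z == -1 %[mod r%:Z])%Z = (r %| k + 1).
Proof. by rewrite eqz_mod_dvd GRing.opprK -PoszD dvdzE. Qed.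

Theorem theorem1p2 (p : nat) (p_prime : prime p) (p_odd : odd p) :
  (forall q k : nat, prime q -> 0 < k ->
     let r := Ord p q in
     logn p (sigma (q ^ k)) =
       if q == 1 %[mod p] then logn p (k + 1)
       else if (p == q) ||
               ((q != 1 %[mod p]) && (k%:Z != -1 %[mod r%:Z])%Z) then 0
       else logn p (k + 1) + logn p (q ^ r - 1)) /\
  (forall n : nat, 0 < n ->
     logn p (sigma n) =
       \sum_(q <- primes n | q == 1 %[mod p]) logn p (logn q n + 1) +
       \sum_(q <- primes n | [&& q != p, q != 1 %[mod p]
                               & Ord p q %| logn q n + 1])
          (logn p (logn q n + 1) + logn p (q ^ Ord p q - 1))).
Proof.
have partA q k : prime q -> 0 < k -> logn p (sigma (q ^ k)) =
    if q == 1 %[mod p] then logn p (k + 1)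
    else if (p == q) ||
            ((q != 1 %[mod p]) && (k%:Z != -1 %[mod (Ord p q)%:Z])%Z) then 0
    else logn p (k + 1) + logn p (q ^ Ord p q - 1).
  move=> q_prime k_gt0; rewrite sigma_primeX // -addn1.
  have q_gt0 := prime_gt0 q_prime.
  case: eqP => [q1|/eqP q1] /=; first by rewrite logn_geom_sum // addn1.
  have [eq_pq|neq_pq] := eqVneq p q; rewrite eqz_modN1 /=.
    (* For [q = p] every term after the initial 1 is a multiple of [p]. *)
    rewrite addn1 big_ord_recl expn0; apply: logn_coprime.
    rewrite prime_coprime // dvdn_addl ?dvdn1 ?neq_ltn ?prime_gt1 ?orbT //.
    by apply: dvdn_sum => i _; rewrite eq_pq expnS dvdn_mulr.
  have qp : coprime q p by rewrite prime_coprime // dvdn_prime2 // eq_sym.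
  have [/dvdnP[m mE]|] /= := boolP (Ord p q %| k + 1).
    have m_gt0 : 0 < m by case: m mE => //; rewrite addn1.
    have [_ r1 _] := Ord_spec qp.
    rewrite mE mulnC geom_sumM lognM ?geom_sum_gt0 //; last by case: (Ord_spec qp).
    rewrite logn_geom_sum_neq1 // logn_geom_sum // addnC.
    by rewrite logn_Gauss // coprime_Ord.
  rewrite Ord_dvdn // => qk1; rewrite logn_geom_sum_neq1 //.
  by rewrite logn_coprime // prime_coprime // -eqn_mod_dvd // expn_gt0 q_gt0.
split=> // n n_gt0; rewrite logn_sigma //.
(* Both filtered sums become sums over all primes of [n], with 0 where the condition fails, so part
   (a) can be applied prime by prime. *)
rewrite [X in X + _]big_mkcond [X in _ + X]big_mkcond -big_split /=.
apply: eq_big_seq => q q_n; have := q_n; rewrite mem_primes => /andP[q_prime _].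
rewrite partA ?logn_gt0 // eqz_modN1 (eq_sym p q).
by case: (q == 1 %[mod p]); case: (q == p); case: (_ %| _); rewrite //= addn0.
Qed.
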